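(* Let $k\ge 1$ and let $\Lambda$ be a finitely aligned $k$-graph. Let $W$ be the path space of $\Lambda$ and $Y\subset W$ its set of finite paths. Then $W$, with the topology of pointwise convergence on $Y$ (i.e. the topology making the injective map $\alpha:W\to\{0,1\}^{Y}$ a homeomorphism onto its image, $\{0,1\}^Y$ having the product topology), is a locally compact metric space (i.e. locally compact and metrizable). Moreover this topology is the disjoint union topology of the compact spaces $W_v$, $v\in\Lambda^0$ (each $W_v$ being given the topology of pointwise convergence on $Y$).
   Context: $\mathbb{N}=\{0,1,2,\dots\}$. $\mathbb{N}^k$ is ordered coordinatewise, and $(m\vee n)_i=\max\{m_i,n_i\}$; the order is extended coordinatewise to $(\mathbb{N}\cup\{\infty\})^k$. $\mathbb{N}^k$ is regarded as a category with one object, with addition as composition. A $k$-graph is a countable small category $\Lambda$ (identified with its set of morphisms, with range and source maps $r,s$; the product $\mu\nu$ is defined when $s(\mu)=r(\nu)$) together with a functor $d:\Lambda\to\mathbb{N}^k$ (degree map) with unique factorization: if $d(\lambda)=m+n$ with $m,n\in\mathbb{N}^k$, there are unique $\mu,\nu\in\Lambda$ with $\lambda=\mu\nu$, $d(\mu)=m$, $d(\nu)=n$. Write $\mu\le\lambda$ if $\lambda=\mu\nu$ for some $\nu\in\Lambda$. Put $\Lambda^n=d^{-1}(n)$; $\Lambda^0$ is identified with the set of objects. $\Lambda$ is finitely aligned if for all $\lambda,\mu\in\Lambda$ the set $\{\nu\in\Lambda:\lambda\le\nu,\ \mu\le\nu,\ d(\nu)=d(\lambda)\vee d(\mu)\}$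 is finite. For $N\in(\mathbb{N}\cup\{\infty\})^k$, an $N$-path is a family $w=\{w_m: m\in\mathbb{N}^k, m\le N\}$ in $\Lambda$ with $d(w_m)=m$ and $w_m\le w_n$ whenever $m\le n$. $W^N$ is the set of $N$-paths and $W=\bigcup_{N}W^N$ (over all $N\in(\mathbb{N}\cup\{\infty\})^k$) is the path space. For $N\in\mathbb{N}^k$, an $N$-path $w$ is identified with the single element $w_N\in\Lambda^N$; thus the set $Y=\bigcup_{N\in\mathbb{N}^k}W^N$ of finite paths is identified with $\Lambda$. For $y\in Y$ and $w\in W^N$, write $y\le w$ if $d(y)\le N$ and $w_{d(y)}=y$ (this agrees with the order above when $w\in Y$). For $v\in\Lambda^0$, $W_v=\{w\in W: w_0=v\}$. The map $\alpha:W\to\{0,1\}^Y$ is given by $\alpha(w)(y)=1$ if $y\le w$ and $\alpha(w)(y)=0$ otherwise; it is injective. *)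

(* Defs.v *)
From HB Require Import structures.
From mathcomp Require Import all_boot all_order all_algebra.
From mathcomp Require Import all_classical all_reals all_analysis.

Set Implicit Arguments.
Unset Strict Implicit.
Unset Printing Implicit Defensive.

Import Order.TTheory GRing.Theory Num.Theory.

Local Open Scope classical_set_scope.
Local Open Scope ring_scope.

(* N^k, with the coordinatewise addition that the library puts on finite
   functions. *)
Notation natvec k := {ffun 'I_k -> nat}.

(* (N u {oo})^k, with None standing for oo. *)
Notation enatvec k := {ffun 'I_k -> option nat}.

Definition vle k (m n : natvec k) : bool := [forall i, (m i <= n i)%N].

Definition vjoin k (m n : natvec k) : natvec k := [ffun i => maxn (m i) (n i)].

Definition vle_ext k (m : natvec k) (N : enatvec k) : bool :=
  [forall i, if N i is Some n then (m i <= n)%N else true].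

Lemma vle_ext0 k (N : enatvec k) : vle_ext 0 N.
Proof. by apply/forallP => i; rewrite ffunE; case: (N i). Qed.

(* [kmul mu nu] is the product mu nu; it is meaningful only when
   [src mu = rng nu] and unconstrained otherwise. *)
Record kgraph (k : nat) := KGraph {
  obj : countType;
  mor : countType;
  rng : mor -> obj;
  src : mor -> obj;
  idm : obj -> mor;
  kmul : mor -> mor -> mor;
  deg : mor -> natvec k;
  rng_idm : forall v, rng (idm v) = v;
  src_idm : forall v, src (idm v) = v;
  rng_comp : forall mu nu, src mu = rng nu -> rng (kmul mu nu) = rng mu;
  src_comp : forall mu nu, src mu = rng nu -> src (kmul mu nu) = src nu;
  comp_idl : forall mu, kmul (idm (rng mu)) mu = mu;
  comp_idr : forall mu, kmul mu (idm (src mu)) = mu;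
  compA : forall la mu nu, src la = rng mu -> src mu = rng nu ->
    kmul la (kmul mu nu) = kmul (kmul la mu) nu;
  deg_idm : forall v, deg (idm v) = 0;
  deg_comp : forall mu nu, src mu = rng nu ->
    deg (kmul mu nu) = deg mu + deg nu;
  unique_factorization : forall la m n, deg la = m + n ->
    exists! p : mor * mor,
      [/\ src p.1 = rng p.2, la = kmul p.1 p.2, deg p.1 = m & deg p.2 = n]
}.

Section PathSpace.
Variables (k : nat) (L : kgraph k).

Definition kle (mu la : mor L) : Prop :=
  exists2 nu, src mu = rng nu & la = kmul mu nu.

Definition finitely_aligned : Prop :=
  forall la mu : mor L,
    finite_set [set nu | [/\ kle la nu, kle mu nu &
                             deg nu = vjoin (deg la) (deg mu)]].

(* An element of W: a bound N together with an N-path.  The family is only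
   defined on the indices m <= N, so that paths with different bounds are
   different. *)
Record kpath := KPath {
  pbound : enatvec k;
  fam : forall m : natvec k, vle_ext m pbound -> mor L;
  fam_deg : forall m (hm : vle_ext m pbound), deg (fam hm) = m;
  fam_le : forall m n (hm : vle_ext m pbound) (hn : vle_ext n pbound),
    vle m n -> kle (fam hm) (fam hn)
}.

HB.instance Definition _ := gen_eqMixin kpath.
HB.instance Definition _ := gen_choiceMixin kpath.

(* y <= w, the finite path y being identified with an element of L. *)
Definition path_le (y : mor L) (w : kpath) : Prop :=
  exists h : vle_ext (deg y) (pbound w), fam h = y.

Definition alpha (w : kpath) : {ptws mor L -> bool} := fun y => `[< path_le y w >].

Lemma alpha_inj : injective alpha.
Proof.
suff bnd w w' : alpha w = alpha w' -> forall m (h : vle_ext m (pbound w)),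
    exists h' : vle_ext m (pbound w'), fam h' = fam h.
  move=> w w' e; have h1 := bnd _ _ e; have h2 := bnd _ _ (esym e).
  have sub (u u' : kpath) : (forall m (h : vle_ext m (pbound u)),
      exists h' : vle_ext m (pbound u'), fam h' = fam h) ->
      forall i n, pbound u' i = Some n ->
      exists2 p, pbound u i = Some p & (p <= n)%N.
    move=> H i n ui.
    pose e_ (a : nat) : natvec k := [ffun j => if j == i then a else 0%N].
    have eP a : (if pbound u i is Some p then (a <= p)%N else true) ->
        (a <= n)%N.
      move=> ha; have he : vle_ext (e_ a) (pbound u).
        apply/forallP => j; rewrite ffunE; case: eqVneq => [->//|_].
        by case: (pbound u j).
      have [hn _] := H _ he; move/forallP: (hn) => /(_ i).
      by rewrite ui ffunE eqxx.
    case ub: (pbound u i) eP => [p|] eP; first by exists p => //; exact: eP.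
    by have := eP n.+1 isT; rewrite ltnn.
  have eb : pbound w = pbound w'.
    apply/ffunP => i; case e1: (pbound w i) => [a|]; case e2: (pbound w' i) => [b|] //.
    - have [p] := sub _ _ h1 _ _ e2; rewrite e1 => -[<-] ab.
      have [q] := sub _ _ h2 _ _ e1; rewrite e2 => -[<-] ba.
      by congr Some; apply/eqP; rewrite eqn_leq ab ba.
    - by have [q] := sub _ _ h2 _ _ e1; rewrite e2.
    - by have [q] := sub _ _ h1 _ _ e2; rewrite e1.
  case: w w' eb {e h2 sub} h1 => [N f fd fl] [N' f' fd' fl'] /= eb.
  subst N' => h1.
  have ef : f = f'.
    apply: functional_extensionality_dep => m.
    apply: functional_extensionality_dep => h.
    by have [h' <-] := h1 m h; rewrite (bool_irrelevance h' h).
  by subst f'; congr KPath; exact: Prop_irrelevance.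
move=> e m h; have : path_le (fam h) w.
  suff: forall n (p : n = m), exists h' : vle_ext n (pbound w), fam h' = fam h.
    by apply; exact: fam_deg.
  by move=> n p; subst n; exists h.
have : alpha w (fam h) = alpha w' (fam h) by rewrite e.
rewrite /alpha => ee /asboolP; rewrite ee => /asboolP [].
by rewrite fam_deg => h' eh; exists h'.
Qed.

(* As alpha is injective, the initial topology is the one that makes alpha a
   homeomorphism onto its image in {0,1}^Y. *)
Definition path_space : topologicalType := initial_topology alpha.

Definition paths_at (v : obj L) : set kpath :=
  [set w | fam (vle_ext0 (pbound w)) = idm v].

Definition path_space_at (v : obj L) : topologicalType :=
  initial_topology (fun w : paths_at v => alpha (set_val w)).

Definition union_map (x : {v : obj L & path_space_at v}) : path_space :=
  set_val (projT2 x : paths_at (projT1 x)).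

End PathSpace.

Definition homeomorphism (T U : topologicalType) (f : T -> U) : Prop :=
  exists g : U -> T, [/\ cancel f g, cancel g f, continuous f & continuous g].

Definition metrizable (R : realType) (T : topologicalType) : Prop :=
  exists (M : metricType R) (f : T -> M), homeomorphism f.

(* Main.v *)
Require Import Defs.
From HB Require Import structures.
From mathcomp Require Import all_boot all_order all_algebra.
From mathcomp Require Import all_classical all_reals all_analysis.

(* Under alpha, W_v becomes the set of those S in {0,1}^Y that contain v, are
   closed under prefixes, and contain, with any two members, one of their
   minimal common extensions.  Finite alignment makes the last condition a
   condition on finitely many coordinates, so W_v is closed in {0,1}^Y and
   Tychonoff applies.  Since w lies in W_v exactly when v <= w, each W_v is the
   trace of a clopen coordinate condition, which gives local compactness and
   the disjoint union topology.  A metric on {0,1}^Y is obtained by taking the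
   largest weight 1/(n+1) of a coordinate, numbered n, at which two points
   differ. *)

Set Implicit Arguments.
Unset Strict Implicit.
Unset Printing Implicit Defensive.

Import Order.TTheory GRing.Theory Num.Theory.

Local Open Scope classical_set_scope.

(** * The product topology on {0,1}^Y *)

Section bool_product.
Variable Y : choiceType.
Implicit Types (S T : {ptws Y -> bool}) (D : set Y).

Lemma ptws_nbhs_coord S y : nbhs S [set T | T y = S y].
Proof.
exact: (@proj_continuous _ (fun=> bool) y S _ (discrete_set1 (S y))).
Qed.

Lemma ptws_nbhs_finite S D : finite_set D ->
  nbhs S [set T | forall y, D y -> T y = S y].
Proof.
move=> /finite_fsetP[D' ->].
have := @filter_bigI _ _ D' _ _ (nbhs_filter S) (fun y _ => ptws_nbhs_coord S y).
by apply: filterS => T; exact.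
Qed.

(** The product topology is the supremum of the topologies pulled back along the coordinates, and
    [bool] is discrete, so convergence at a coordinate is eventual equality there. *)
Lemma cvg_ptws (F : set_system {ptws Y -> bool}) S : Filter F ->
  (forall y, \forall T \near F, T y = S y) -> F --> S.
Proof.
move=> FF FS; apply/cvg_sup => y A [_ [[U _ <-] US] UA].
by apply: filterS (FS y) => T TS; apply: UA; rewrite /= /proj TS.
Qed.

Lemma ptws_clopen_coord y : clopen [set T : {ptws Y -> bool} | T y].
Proof.
have cp := @proj_continuous _ (fun _ : Y => bool) y.
split; first exact: (open_comp (fun T _ => cp T) (discrete_open (fun b : bool => b))).
exact: (closed_comp (fun T _ => cp T) (discrete_closed (fun b : bool => b))).
Qed.

Lemma ptws_compact : compact [set: {ptws Y -> bool}].
Proof.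
have := @tychonoff _ (fun _ : Y => _) _ (fun=> bool_compact).
by congr (compact _); rewrite eqEsubset.
Qed.

Lemma ptws_closure_finite (A : set {ptws Y -> bool}) S D : finite_set D ->
  closure A S -> exists2 T, A T & forall y, D y -> T y = S y.
Proof.
by move=> fD /(_ _ (ptws_nbhs_finite S fD))[T [AT TS]]; exists T.
Qed.

End bool_product.

(** Open sets of the initial topology are preimages under [f], so a cluster point of the image
    filter, once known to be some [f p], makes [p] a cluster point of the original filter. *)
Lemma initial_compact (S : choiceType) (T : topologicalType) (f : S -> T) :
  compact (range f) -> compact [set: initial_topology f].
Proof.
move=> cf F FF _.
have FfT : F (f @^-1` range f) by apply: filterS filterT => x _; exists x.
have [_ [[p _ <-] fp]] := cf _ (fmap_proper_filter f FF) FfT.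
exists p; split=> // A B FA [_ [[U oU <-] Up] UB].
have FfA : F (f @^-1` (f @` A)) by apply: filterS FA => x Ax; exists x.
have [_ [[a Aa <-] Ua]] := fp _ _ FfA (open_nbhs_nbhs (conj oU Up)).
by exists a; split=> //; exact: UB.
Qed.

(** * A metric for pointwise convergence on a countable set *)

Section bool_product_metric.
Variables (R : realType) (S : choiceType) (Y : countType).
Variable f : S -> {ptws Y -> bool}.
Local Open Scope ring_scope.

Definition weight (y : Y) : R := (pickle y).+1%:R^-1.

(* When [f x = f z] this is [sup set0], which is 0 by convention. *)
Definition coord_dist (x z : S) : R :=
  sup [set weight y | y in [set y | f x y != f z y]].

Lemma weight_gt0 y : 0 < weight y.
Proof. by rewrite invr_gt0 ltr0n. Qed.

Lemma weight_le1 y : weight y <= 1.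
Proof. by rewrite invf_le1 ?ltr0n// ler1n. Qed.

(** The numbering [pickle] is injective and the weights decrease to 0 along it. This is why every
    ball contains a neighbourhood given by finitely many coordinates. *)
Lemma weight_small (e : R) : 0 < e -> finite_set [set y | e <= weight y].
Proof.
move=> e0; have [n _ /(_ n (leqnn n)) en] := near_infty_natSinv_lt (PosNum e0).
apply: (sub_finite_set _ (finite_preimage (in2W (pcan_inj pickleK)) (finite_II n.+1))).
move=> y /= ey; rewrite ltnS leqNgt; apply/negP => ny.
have : weight y <= n.+1%:R^-1 by rewrite lef_pV2 ?posrE ?ltr0n// ler_nat ltnW.
by move/(le_trans ey); rewrite leNgt en.
Qed.

Lemma coord_dist_ge x z y : f x y != f z y -> weight y <= coord_dist x z.
Proof.
move=> xz; apply: ub_le_sup; last by exists y.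
by exists 1 => _ [t _ <-]; exact: weight_le1.
Qed.

Lemma coord_dist_le x z (e : R) : 0 <= e ->
  (forall y, f x y != f z y -> weight y <= e) -> coord_dist x z <= e.
Proof.
move=> e0 xz; rewrite /coord_dist; set A := [set _ | _ in _].
(* [ge_sup] needs a nonempty set; when no coordinate differs, the default value 0 of [sup] is
   bounded by means of [0 <= e]. *)
have [->|/set0P A0] := eqVneq A set0; first by rewrite sup0.
by apply: ge_sup => // _ [y /= /xz ? <-].
Qed.

Lemma coord_dist_ge0 x z : 0 <= coord_dist x z.
Proof.
have [[y xz]|nxz] := pselect (exists y, f x y != f z y).
  by rewrite (le_trans _ (coord_dist_ge xz))// ltW// weight_gt0.
rewrite /coord_dist (_ : [set _ | _ in _] = set0) ?sup0//.
by rewrite -subset0 => _ [y /= xz _]; apply: nxz; exists y.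
Qed.

Lemma coord_distxx x : coord_dist x x = 0.
Proof.
apply/eqP; rewrite eq_le coord_dist_ge0 andbT.
by apply: coord_dist_le => // y; rewrite eqxx.
Qed.

Lemma coord_dist_sym x z : coord_dist x z = coord_dist z x.
Proof.
suff e : [set y | f x y != f z y] = [set y | f z y != f x y] by rewrite /coord_dist e.
by apply/seteqP; split=> y /=; rewrite eq_sym.
Qed.

(** A coordinate that separates [x] from [z] separates [x] from [y] or [y] from [z], so its weight
    is at most one of the two summands. *)
Lemma coord_dist_triangle y x z :
  coord_dist x z <= coord_dist x y + coord_dist y z.
Proof.
apply: coord_dist_le => [|c xz]; first by rewrite addr_ge0// coord_dist_ge0.
have [xy|xy] := eqVneq (f x c) (f y c).
  by rewrite ler_wpDl ?coord_dist_ge0// coord_dist_ge// -xy.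
by rewrite ler_wpDr ?coord_dist_ge0// coord_dist_ge.
Qed.

Hypothesis f_inj : injective f.

Lemma coord_dist_positivity x z : coord_dist x z = 0 -> x = z.
Proof.
move=> xz0; apply/f_inj/funext => y; apply/eqP/negPn/negP => /coord_dist_ge.
by rewrite xz0 leNgt weight_gt0.
Qed.

(* [R] is recorded in the alias because the topology generated by [isMetric] is
   built from it. *)
Definition coord_metric (_ : injective f) (_ : realType) : Type := S.

HB.instance Definition _ := Choice.on (coord_metric f_inj R).
HB.instance Definition _ := isMetric.Build R (coord_metric f_inj R)
  coord_distxx coord_dist_positivity coord_dist_sym coord_dist_triangle.

Lemma coord_ballE (x : coord_metric f_inj R) (e : R) :
  ball x e = [set z | coord_dist x z < e].
Proof. by []. Qed.

Lemma metrizable_initial : metrizable R (initial_topology f).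
Proof.
exists (coord_metric f_inj R), id, id; split=> //.
- move=> x A /nbhs_ballP[e /= e0 xeA].
  (* Bounding every weight bounds the supremum only weakly; halving [e] makes the inequality
     strict. *)
  have e20 : 0 < e / 2 by rewrite divr_gt0.
  have nx : nbhs (x : initial_topology f)
      [set z | forall y, e / 2 <= weight y -> f z y = f x y].
    exact: initial_continuous (ptws_nbhs_finite (f x) (weight_small e20)).
  apply: filterS nx => z xz; apply: xeA; rewrite coord_ballE /=.
  apply: (@le_lt_trans _ _ (e / 2)); last by rewrite ltr_pdivrMr// ltr_pMr// ltr1n.
  apply: coord_dist_le => [|y]; first exact: ltW.
  apply: contraNT; rewrite -ltNge => /ltW ey; apply/eqP; symmetry; exact: xz.
- apply: continuous_comp_initial => x.
  apply: (@cvg_ptws Y (f @ nbhs (x : coord_metric f_inj R)) (f x)) => y.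
  (* A disagreement at [y] alone already forces a distance of at least [weight y]. *)
  apply/nbhs_ballP; exists (weight y) => /= [|z]; first exact: weight_gt0.
  rewrite coord_ballE /= => xz; apply/eqP/negPn/negP; rewrite eq_sym.
  by move/coord_dist_ge; rewrite leNgt xz.
Qed.

End bool_product_metric.

(** * Order and joins in N^k *)

Section vectors.
Variable k : nat.
Implicit Types (m n p : natvec k) (N : enatvec k).

Lemma vle_refl m : vle m m.
Proof. by apply/forallP. Qed.

Lemma vle_addr m n : vle m (m + n)%R.
Proof. by apply/forallP => i; rewrite ffunE leq_addr. Qed.

Lemma vle_subK m n : vle m n -> exists p, n = (m + p)%R.
Proof.
move=> /forallP mn; exists [ffun i => (n i - m i)%N].
by apply/ffunP => i; rewrite !ffunE; apply/esym/subnKC.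
Qed.

Lemma natvec_addI m : injective (+%R m).
Proof.
by move=> n p /ffunP e; apply/ffunP => i; move: (e i); rewrite !ffunE => /addnI.
Qed.

Lemma vle_joinl m n : vle m (vjoin m n).
Proof. by apply/forallP => i; rewrite ffunE leq_maxl. Qed.

Lemma vle_joinr m n : vle n (vjoin m n).
Proof. by apply/forallP => i; rewrite ffunE leq_maxr. Qed.

Lemma vjoin_idr m n : vle m n -> vjoin m n = n.
Proof. by move=> /forallP mn; apply/ffunP => i; rewrite ffunE; apply/maxn_idPr. Qed.

Lemma vle_ext_trans m n N : vle m n -> vle_ext n N -> vle_ext m N.
Proof.
move=> /forallP mn /forallP nN; apply/forallP => i; move: (nN i).
by case: (N i) => // a; apply: leq_trans.
Qed.

Lemma vle_ext_join m n N : vle_ext m N -> vle_ext n N -> vle_ext (vjoin m n) N.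
Proof.
move=> /forallP mN /forallP nN; apply/forallP => i; move: (mN i) (nN i).
by rewrite ffunE; case: (N i) => // a; rewrite geq_max => -> ->.
Qed.

(** The bound [N] is the coordinatewise supremum of [D], infinite where [D] is unbounded. It becomes
    the bound of the path rebuilt from its set of finite prefixes. *)
Lemma directed_vle_ext (D : set (natvec k)) : D 0%R ->
  (forall m n, vle m n -> D n -> D m) ->
  (forall m n, D m -> D n -> D (vjoin m n)) ->
  exists N, forall m, vle_ext m N <-> D m.
Proof.
move=> D0 Ddown Djoin.
have bnd (i : 'I_k) : exists o : option nat, forall a : nat,
    (if o is Some n then (a <= n)%N else true) <-> exists2 m, D m & (a <= m i)%N.
  have [[b Db]|unb] := pselect (exists b, forall m, D m -> (m i <= b)%N).
    pose P a := `[< exists2 m, D m & m i = a >].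
    have exP : exists a, P a by exists 0%N; apply/asboolP; exists 0%R; rewrite ?ffunE.
    have Pb a : P a -> (a <= b)%N by move=> /asboolP[m /Db + <-].
    case: (ex_maxnP exP Pb) => c /asboolP[m Dm mc] cmax.
    exists (Some c) => a; split=> [ac|[n Dn an]]; first by exists m; rewrite ?mc.
    by apply: (leq_trans an); apply: cmax; apply/asboolP; exists n.
  exists None => a; split=> // _; apply: contrapT => aD; apply: unb; exists a => m Dm.
  by rewrite leqNgt; apply/negP => am; apply: aD; exists m => //; exact: ltnW.
have [N_ NP] := choice bnd; exists [ffun i => N_ i] => m; split=> [mN|Dm].
  (* Each coordinate of [m] is dominated by some member of [D]; the join of these members, built up
     from 0 coordinate by coordinate, dominates [m] in all of them. *)
  suff [p Dp mp] : exists2 p, D p & {in enum 'I_k, forall i, (m i <= p i)%N}.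
    by apply: Ddown Dp; apply/forallP => i; apply: mp; rewrite mem_enum.
  elim: (enum 'I_k) => [|i s [p Dp mp]]; first by exists 0%R.
  have [q Dq mq] : exists2 q, D q & (m i <= q i)%N.
    by apply: (NP i (m i)).1; move/forallP: mN => /(_ i); rewrite ffunE; case: (N_ i).
  exists (vjoin p q) => [|j]; first exact: Djoin.
  by rewrite inE ffunE leq_max => /predU1P[->|/mp ->//]; rewrite mq orbT.
by apply/forallP => i; rewrite ffunE; have := (NP i (m i)).2; case: (N_ i) => // a; apply; exists m.
Qed.

End vectors.

(** * Prefixes in a k-graph and finite prefixes of paths *)

Section kgraph.
Variables (k : nat) (L : kgraph k).
Implicit Types (x y z : mor L) (w : kpath L) (v : obj L) (m n : natvec k).

(** Both [(x, idm (src x))] and [(idm (rng x), x)] factor [x] in degrees 0 and 0, so they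
    coincide. *)
Lemma deg0_idm x : deg x = 0%R -> x = idm (rng x).
Proof.
move=> x0; have [|p [_ up]] := @unique_factorization _ _ x 0%R 0%R.
  by rewrite x0 addr0.
have e1 : p = (x, idm (src x)).
  by apply: up; split=> //=; rewrite ?rng_idm ?comp_idr ?deg_idm.
have e2 : p = (idm (rng x), x).
  by apply: up; split=> //=; rewrite ?src_idm ?comp_idl ?deg_idm.
by move: e1; rewrite e2 => /(congr1 fst) /= ->.
Qed.

Lemma kle_refl x : kle x x.
Proof. by exists (idm (src x)); rewrite ?rng_idm ?comp_idr. Qed.

Lemma kle_deg x y : kle x y -> vle (deg x) (deg y).
Proof. by move=> [z xz ->]; rewrite deg_comp// vle_addr. Qed.

(** By cancellation in N^k the two cofactors also have equal degrees, so both pairs are the unique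
    factorization of [z] in these degrees. *)
Lemma kle_inj x y z : kle x z -> kle y z -> deg x = deg y -> x = y.
Proof.
move=> [x' xx' zx] [y' yy' zy] xy.
have := deg_comp xx'; rewrite -zx => dz.
have := deg_comp yy'; rewrite -zy dz xy => /natvec_addI x'y'.
have [p [_ up]] := unique_factorization dz.
have -> : x = p.1 by rewrite (up (x, x')).
by rewrite (up (y, y')).
Qed.

Lemma kle_deg_eq x y : kle x y -> deg x = deg y -> x = y.
Proof. by move=> xy; apply: kle_inj xy (kle_refl y). Qed.

Lemma kle_prefix m y : vle m (deg y) -> exists2 x, kle x y & deg x = m.
Proof.
move=> /vle_subK[n /unique_factorization[[x z] [[/= xz -> <- _] _]]].
by exists x => //; exists z.
Qed.

(** [path_le] indexes the family by [deg y]; allowing any index equal to it avoids transport along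
    degree equations, as at index 0 for [idm v]. *)
Lemma path_leP m w (h : vle_ext m (pbound w)) y : deg y = m ->
  Defs.path_le y w <-> fam h = y.
Proof.
move=> e; subst m; split=> [[h' e]|]; last by exists h.
by rewrite (bool_irrelevance h h').
Qed.

Lemma path_le_trans x y w : kle x y -> Defs.path_le y w -> Defs.path_le x w.
Proof.
move=> xy [hy ey]; have xN := vle_ext_trans (kle_deg xy) hy; exists xN.
by apply: (@kle_inj _ _ y); rewrite ?fam_deg// -ey; apply/fam_le/kle_deg.
Qed.

Lemma path_le_join x y w : Defs.path_le x w -> Defs.path_le y w ->
  exists z, [/\ kle x z, kle y z, deg z = vjoin (deg x) (deg y) & Defs.path_le z w].
Proof.
move=> [hx ex] [hy ey]; have hz := vle_ext_join hx hy.
exists (fam hz); split; last exact/(path_leP hz (fam_deg hz)).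
- by have := fam_le hx hz (vle_joinl _ _); rewrite ex.
- by have := fam_le hy hz (vle_joinr _ _); rewrite ey.
- by rewrite fam_deg.
Qed.

Lemma path_le_idm w v : Defs.path_le (idm v) w <-> paths_at v w.
Proof. exact/path_leP/deg_idm. Qed.

Lemma path_at_rng w : paths_at (rng (fam (vle_ext0 (pbound w)))) w.
Proof. by rewrite /paths_at /= -deg0_idm ?fam_deg. Qed.

Lemma paths_at_inj w v v' : paths_at v w -> paths_at v' w -> v = v'.
Proof.
by rewrite /paths_at /= => -> /(congr1 (@rng _ _)); rewrite !rng_idm.
Qed.

(** * Points of {0,1}^Y that come from paths *)

Definition path_filter v : set {ptws mor L -> bool} :=
  [set S | [/\ S (idm v), forall x y, kle x y -> S y -> S x &
    forall x y, S x -> S y ->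
      exists z, [/\ kle x z, kle y z, deg z = vjoin (deg x) (deg y) & S z]]].

Lemma alpha_path_filter v w : paths_at v w -> path_filter v (alpha w).
Proof.
move=> wv; split=> [|x y xy /asboolP yw|x y /asboolP xw /asboolP yw].
- exact/asboolP/path_le_idm.
- exact/asboolP/(path_le_trans xy).
- have [z [xz yz dz zw]] := path_le_join xw yw.
  by exists z; split=> //; apply/asboolP.
Qed.

(** The degrees of the members of [S] are exactly those below some bound [N], and [S] has a single
    member in each such degree; these members form the path. *)
Lemma path_filter_alpha v (S : {ptws mor L -> bool}) : path_filter v S ->
  exists2 w, paths_at v w & alpha w = S.
Proof.
move=> [Sv Sdown Sjoin].
have Sinj x y : S x -> S y -> vle (deg x) (deg y) -> kle x y.
  move=> Sx Sy xy; have [z [xz yz dz Sz]] := Sjoin _ _ Sx Sy.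
  (* The join of the degrees is [deg y], so the common extension [z] is [y] itself. *)
  by rewrite (kle_deg_eq yz)// dz vjoin_idr.
have Seq x y : S x -> S y -> deg x = deg y -> x = y.
  by move=> Sx Sy xy; apply: kle_deg_eq => //; apply: Sinj; rewrite // xy vle_refl.
have [N NP] : exists N, forall m, vle_ext m N <-> exists2 x, S x & deg x = m.
  apply: (@directed_vle_ext _ [set m | exists2 x, S x & deg x = m]) => /=.
  - by exists (idm v); rewrite ?deg_idm.
  - move=> m n mn [y Sy yn]; rewrite -yn in mn.
    by have [x xy xm] := kle_prefix mn; exists x => //; exact: Sdown xy Sy.
  - move=> m n [x Sx <-] [y Sy <-].
    by have [z [_ _ dz Sz]] := Sjoin _ _ Sx Sy; exists z.
have ex m (h : vle_ext m N) : exists x, S x /\ deg x = m.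
  by have [x] := (NP m).1 h; exists x.
pose f m h := sval (cid (ex m h)).
have fS m h : S (f m h) by case: (svalP (cid (ex m h))).
have fdeg m h : deg (f m h) = m by case: (svalP (cid (ex m h))).
have fle m n hm hn : vle m n -> kle (f m hm) (f n hn).
  by move=> mn; apply: Sinj; rewrite ?fS ?fdeg.
pose w := KPath fdeg fle.
have wS y : Defs.path_le y w <-> S y.
  split=> [[h <-]|Sy]; first exact: fS.
  have h : vle_ext (deg y) N by apply/NP; exists y.
  by exists h; apply: Seq; rewrite /= ?fS ?fdeg.
exists w; first exact/path_le_idm/wS.
by apply/funext => y; apply/idP/idP => [/asboolP/wS|/wS/asboolP].
Qed.

Lemma range_alpha_at v :
  range (fun w : paths_at v => alpha (set_val w)) = path_filter v.
Proof.
apply/seteqP; split=> [_ [w _ <-]|S /path_filter_alpha[w wv <-]].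
  exact/alpha_path_filter/set_valP.
by exists (SigSub (mem_set wv)).
Qed.

(* Finite alignment makes the existence of a minimal common extension in [S] a
   condition on finitely many coordinates of [S]. *)
Lemma path_filter_closed v : finitely_aligned L -> closed (path_filter v).
Proof.
move=> fa S clS.
have agree D : finite_set D -> exists2 T, path_filter v T & forall y, D y -> T y = S y.
  by move=> fD; exact: ptws_closure_finite fD clS.
split.
- have [T [Tv _ _] TS] := agree _ (finite_set1 (idm v)).
  by rewrite -TS.
- move=> x y xy; have [T [_ Td _] TS] := agree _ (finite_set2 x y).
  by rewrite -(TS x) -?(TS y); [exact: Td|right|left].
(* [T] agrees with [S] at [x], at [y] and at all their minimal common extensions, so the extension
   found in [T] lies in [S]. *)
- move=> x y; have [|T [_ _ Tj] TS] :=
      agree ([set x; y] `|` [set z | [/\ kle x z, kle y z &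
        deg z = vjoin (deg x) (deg y)]]).
    by rewrite finite_setU; split; [exact: finite_set2|exact: fa].
  rewrite -(TS x) -?(TS y); [|by left; right|by left; left].
  move=> Tx /(Tj _ _ Tx)[z [xz yz dz Tz]]; exists z; split=> //.
  by rewrite -TS//; right.
Qed.

(** * Each W_v is compact and clopen in W *)

Lemma path_space_at_compact v : finitely_aligned L ->
  compact [set: path_space_at v].
Proof.
move=> fa; apply: initial_compact; rewrite range_alpha_at.
exact: subclosed_compact (path_filter_closed fa) (@ptws_compact _) _.
Qed.

Lemma paths_at_clopen v : clopen (paths_at v : set (path_space L)).
Proof.
have -> : paths_at v = @alpha k L @^-1` [set T | T (idm v)].
  by apply/seteqP; split=> w; rewrite /= asboolE => /path_le_idm.
have ca := @initial_continuous _ _ (@alpha k L).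
have [oi ci] := ptws_clopen_coord (idm v).
by split; [apply: open_comp oi => w _; exact: ca|apply: closed_comp ci => w _; exact: ca].
Qed.

Lemma set_val_paths_continuous v :
  continuous (fun w : path_space_at v => set_val (w : paths_at v) : path_space L).
Proof. by apply: continuous_comp_initial; exact: initial_continuous. Qed.

(** * The disjoint union topology and local compactness *)

Lemma union_map_continuous : continuous (@union_map k L).
Proof. by move=> [v w] A nA; exact: (@set_val_paths_continuous v w). Qed.

Definition union_inv (w : path_space L) : {v : obj L & path_space_at v} :=
  existT _ (rng (fam (vle_ext0 (pbound w)))) (SigSub (mem_set (path_at_rng w))).

Lemma union_invE v (w : paths_at v) :
  union_inv (set_val w) = existT _ v w.
Proof.
rewrite /union_inv; have wv := set_valP w.
(* The vertex is generalized together with its proof, so that [subst] can identify it with [v]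
   inside the dependent pair. *)
move: (rng _) (path_at_rng _) => v' wv'.
have vv' := paths_at_inj wv' wv; subst v'.
by congr existT; apply: val_inj.
Qed.

Lemma union_mapK : cancel (@union_map k L) union_inv.
Proof. by move=> [v w]; exact: union_invE. Qed.

Lemma union_invK : cancel union_inv (@union_map k L).
Proof. by []. Qed.

(** W_v is open, so continuity at [w] can be tested on W_v, where the first component stays [v] and
    the topology is the one pulled back along [alpha]. *)
Lemma union_inv_continuous : continuous union_inv.
Proof.
move=> w A [_ [[U oU <-] Uw] UA].
have wv := path_at_rng w; set v := rng _ in wv *.
have nU : nbhs w (@alpha k L @^-1` U).
  by apply: initial_continuous; apply: open_nbhs_nbhs.
have nv : nbhs w (paths_at v).
  by apply: open_nbhs_nbhs; split=> //; case: (paths_at_clopen v).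
apply: filterS2 nU nv => w' Uw' w'v.
have := UA (SigSub (mem_set w'v)) Uw'.
by rewrite /= -union_invE.
Qed.

Lemma union_map_homeomorphism : homeomorphism (@union_map k L).
Proof.
exists union_inv; split; [exact: union_mapK|exact: union_invK|
  exact: union_map_continuous|exact: union_inv_continuous].
Qed.

(** The inclusion of W_v into W is continuous, which carries compactness from the space W_v over to
    the subset of W. *)
Lemma paths_at_compact v : finitely_aligned L ->
  compact (paths_at v : set (path_space L)).
Proof.
move=> fa; have cv := @path_space_at_compact v fa.
have := continuous_compact (continuous_subspaceT (@set_val_paths_continuous v)) cv.
congr compact; apply/seteqP; split=> [_ [w _ <-]|w wv]; first exact: set_valP.
by exists (SigSub (mem_set wv)).
Qed.

Lemma path_space_locally_compact : finitely_aligned L ->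
  locally_compact [set: path_space L].
Proof.
move=> fa w _; have wv := path_at_rng w.
move: (rng _) wv => v wv; have [op cl] := paths_at_clopen v.
exists (paths_at v); last by split; [exact: paths_at_compact|].
rewrite withinET; exact: open_nbhs_nbhs.
Qed.

End kgraph.

Theorem corollary2p3 (R : realType) (k : nat) (hk : (1 <= k)%N)
    (L : kgraph k) (hL : finitely_aligned L) :
  [/\ locally_compact [set: path_space L],
      metrizable R (path_space L),
      forall v : obj L, compact [set: path_space_at v]
    & homeomorphism (@union_map k L)].
Proof.
split; [exact: path_space_locally_compact|exact/metrizable_initial/alpha_inj|
  by move=> v; exact: path_space_at_compact|exact: union_map_homeomorphism].
Qed.
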